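(* Let $k\ge 2$ be an integer. For an integer $\theta\ge k$, let $X_{(k)}$ be the $k$-th smallest of $\theta$ independent random variables uniform on $[0,1]$, and set $$\hat{\xi}(X_{(k)})=\frac{k-1}{X_{(k)}}.$$ Then $\hat{\xi}$ is an unbiased estimator of $\theta$: $\mathbb{E}_\theta[\hat{\xi}(X_{(k)})]=\theta$ for every $\theta\geq k$. Furthermore, $\hat{\xi}$ is the unbiased estimator of $\theta$ with the lowest variance: for every measurable $\phi$ such that $\mathbb{E}_\theta[\phi(X_{(k)})]=\theta$ for all integers $\theta\ge k$, one has $\mathrm{Var}_\theta(\hat{\xi}(X_{(k)}))\le \mathrm{Var}_\theta(\phi(X_{(k)}))$ for all integers $\theta\ge k$.
   Context: This is the output of the algorithm MinCount with parameter $m=1$ (no splitting of $[0,1]$), which keeps the $k$ smallest among the hashed values; the set of hashed values is distributed as a set of $\theta$ independent uniform random variables on $[0,1]$, where $\theta$ is the unknown number of distinct elements. $\mathbb{E}_\theta$ and $\mathrm{Var}_\theta$ refer to this law with parameter $\theta$. Estimators are measurable functions of the observation $X_{(k)}$. Variances are taken in $[0,+\infty]$. *)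

(* Defs.v *)
From mathcomp Require Import all_boot all_order all_algebra.
From mathcomp Require Import all_classical all_reals all_analysis.

Set Implicit Arguments.
Unset Strict Implicit.
Unset Printing Implicit Defensive.

Import Order.TTheory GRing.Theory Num.Theory.
Import numFieldNormedType.Exports.

Local Open Scope classical_set_scope.
Local Open Scope ring_scope.

Definition mutually_independent d (T : measurableType d) (R : realType)
    (P : probability T R) (n : nat) (X : 'I_n -> {RV P >-> R}) : Prop :=
  forall (J : {set 'I_n}) (A : 'I_n -> set R),
    (forall i, i \in J -> measurable (A i)) ->
    P (\bigcap_(i in [set` J]) (X i @^-1` A i)) =
      (\prod_(i in J) P (X i @^-1` A i))%E.

Definition uniform01 d (T : measurableType d) (R : realType)
    (P : probability T R) (X : {RV P >-> R}) : Prop :=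
  forall A : set R, measurable A ->
    distribution P X A = uniform_prob (@ltr01 R) A.

Definition iid_uniform01 d (T : measurableType d) (R : realType)
    (P : probability T R) (n : nat) (X : 'I_n -> {RV P >-> R}) : Prop :=
  mutually_independent X /\ forall i, uniform01 (X i).

(* [k] counts from 1; only used for [1 <= k <= n] (the default value [0] of
   [nth] is returned when [n < k]). *)
Definition kth_smallest (R : realType) (T : Type) (k n : nat)
    (X : 'I_n -> T -> R) (w : T) : R :=
  nth 0 (sort <=%R [seq X i w | i <- enum 'I_n]) k.-1.

(* At the value [0], taken with probability zero, division gives [0]. *)
Definition xi_hat (R : realType) (k : nat) (x : R) : R := (k%:R - 1) / x.

(* [T theta], [P theta], [X theta] model the sample of size [theta]; only the
   indices [theta >= k] matter. The estimator [phi] is the same for all of them.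
   Integrals being [oo - oo = -oo] when both parts of the integrand are infinite,
   an expectation equal to [theta%:R%:E] entails integrability. *)
Definition unbiased (R : realType) (k : nat) (d : nat -> measure_display)
    (T : forall theta, measurableType (d theta))
    (P : forall theta, probability (T theta) R)
    (X : forall theta, 'I_theta -> {RV (P theta) >-> R})
    (phi : R -> R) : Prop :=
  measurable_fun [set: R] phi /\
  forall theta : nat, (k <= theta)%N ->
    ('E_(P theta)[phi \o kth_smallest k (@X theta)] = theta%:R%:E)%E.

(* Main.v *)
From HB Require Import structures.
Require Import Defs.
From mathcomp Require Import all_boot all_order all_algebra.
From mathcomp Require Import all_classical all_reals all_analysis.
From mathcomp Require Import measurable_realfun.
From mathcomp Require Import ring lra zify.

(** The argument is the Lehmann-Scheffe one. At least [k] of the [n] points lie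
below [x] with a probability that is a binomial tail in [x]; its derivative
telescopes to a single monomial [x^(k-1) (1-x)^(n-k)], so [X_(k)] has the
Beta(k, n-k+1) law ([kth_smallest_cdf], [kth_smallest_beta]). Every expectation
or variance of a function of [X_(k)] is therefore a Lebesgue integral against the
beta density ([expectation_kth_smallest], [variance_kth_smallest]). For
[(k-1)/x] that integral is a quotient of two beta functions and equals [n]
([integral_xi_hat_beta]).

Optimality holds because the family of beta densities indexed by [n >= k] is
complete: if [phi] is another unbiased estimator, then
[g x = (phi x - xi x) x^(k-1)] is integrable on [[0, 1]] and orthogonal to every
[(1-x)^m], which forces [g = 0] almost everywhere ([beta_family_complete]). So
[phi] and [xi] agree almost everywhere on [[0, 1]] and have the same variance,
finite or not: there is essentially one unbiased estimator.

That a function orthogonal to all the [(1-x)^m] vanishes ([moments_ae_eq0]) is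
obtained without the Weierstrass theorem: the explicit polynomials
[(1 - y^n)^M] with [M] close to [t^-n] converge boundedly to the indicator of
[y < t], hence [g] has zero integral on every [[0, s]], and Lebesgue
differentiation recovers [g]. *)

Set Implicit Arguments.
Unset Strict Implicit.
Unset Printing Implicit Defensive.

Import Order.TTheory GRing.Theory Num.Theory.
Import numFieldNormedType.Exports.

Local Open Scope classical_set_scope.
Local Open Scope ring_scope.

(** * Polynomials approximating a step *)

Lemma bernoulli_inequality (R : realType) (a : R) (m : nat) :
  0 <= a <= 1 -> 1 - m%:R * a <= (1 - a) ^+ m.
Proof.
move=> /andP[a0 a1]; elim: m => [|m ih]; first by rewrite mul0r subr0 expr0.
rewrite exprS (le_trans _ (ler_wpM2l _ ih)) ?subr_ge0//.
have m0 : 0 <= m%:R :> R by [].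
by rewrite -natr1; nra.
Qed.

(** The companion upper bound [(1 - a)^m <= 1 / (1 + m a)], which is what forces
the powers to [0] once [m a] is large. *)
Lemma bernoulli_inequality_upper (R : realType) (a : R) (m : nat) :
  0 <= a <= 1 -> (1 - a) ^+ m * (1 + m%:R * a) <= 1.
Proof.
move=> /andP[a0 a1]; elim: m => [|m ih]; first by rewrite mul0r addr0 expr0 mulr1.
apply: le_trans ih; rewrite exprSr -mulrA ler_wpM2l ?exprn_ge0 ?subr_ge0//.
have m0 : 0 <= m%:R :> R by [].
by rewrite -natr1; nra.
Qed.

(** An integer just above [t^-n]: then [step_exponent t n * y^n] is of the order of
[(y / t)^n], which tends to [0] or to infinity according to the side of [t] on
which [y] lies. *)
Definition step_exponent (R : realType) (t : R) (n : nat) : nat :=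
  (Num.truncn (t ^- n)).+1.

Definition step_poly (R : realType) (t : R) (n : nat) : {poly R} :=
  (1 - 'X^n) ^+ step_exponent t n.

Lemma step_polyE (R : realType) (t : R) (n : nat) (y : R) :
  (step_poly t n).[y] = (1 - y ^+ n) ^+ step_exponent t n.
Proof. by rewrite /step_poly !hornerE. Qed.

Lemma step_poly_itv (R : realType) (t y : R) (n : nat) : 0 <= y <= 1 ->
  0 <= (step_poly t n).[y] <= 1.
Proof.
move=> /andP[y0 y1]; rewrite step_polyE.
have yn0 : 0 <= y ^+ n by exact: exprn_ge0.
have yn1 : y ^+ n <= 1 by exact: exprn_ile1.
by rewrite exprn_ge0 ?exprn_ile1 ?subr_ge0 ?lerBlDr ?lerDl.
Qed.

(** Bernoulli's inequality bounds the value from below by [1 - 2 (y/t)^n]: the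
factor [2] absorbs the rounding in the exponent, as [1 <= t^-n]. *)
Lemma step_poly_cvg1 (R : realType) (t y : R) : 0 < t <= 1 -> 0 <= y < t ->
  (step_poly t n).[y] @[n --> \oo] --> (1 : R).
Proof.
move=> /andP[t0 t1] /andP[y0 yt].
have y01 : 0 <= y <= 1 by rewrite y0 (le_trans (ltW yt)).
apply: (@squeeze_cvgr _ _ _ _ (fun n => 1 - 2 * (y / t) ^+ n) (cst 1)); last 2 first.
- rewrite -[X in _ --> X]subr0; apply: cvgB; first exact: cvg_cst.
  rewrite -[X in _ --> X](mulr0 2); apply: cvgM; first exact: cvg_cst.
  have yt1 : `|y / t| < 1.
    by rewrite ger0_norm ?divr_ge0 ?(ltW t0)// ltr_pdivrMr ?mul1r.
  exact: cvg_expr yt1.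
- exact: cvg_cst.
apply: nearW => n; have /andP[_ ->] := step_poly_itv t n y01; rewrite andbT.
rewrite step_polyE; apply: le_trans (bernoulli_inequality _ _); last first.
  by case/andP: y01 => _ y1; rewrite exprn_ge0// exprn_ile1.
rewrite lerD2l lerN2 expr_div_n.
have tn0 : 0 < t ^+ n by rewrite exprn_gt0.
have tn1 : 1 <= t ^- n by rewrite invf_ge1// exprn_ile1// ltW.
rewrite [leRHS](_ : _ = (2 * t ^- n) * y ^+ n); last by ring.
rewrite ler_wpM2r ?exprn_ge0// /step_exponent -natr1 mulrDl mul1r lerD//.
by rewrite truncn_le invr_ge0 ltW.
Qed.

(** The upper Bernoulli bound and [t^-n <= step_exponent t n] give the majorant
[(t/y)^n]. *)
Lemma step_poly_cvg0 (R : realType) (t y : R) : 0 < t -> t < y <= 1 ->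
  (step_poly t n).[y] @[n --> \oo] --> (0 : R).
Proof.
move=> t0 /andP[ty y1]; have y0 : 0 < y by exact: lt_trans t0 ty.
have y01 : 0 <= y <= 1 by rewrite (ltW y0).
apply: (@squeeze_cvgr _ _ _ _ (cst 0) (fun n => (t / y) ^+ n)); last 2 first.
- exact: cvg_cst.
- have ty1 : `|t / y| < 1.
    by rewrite ger0_norm ?divr_ge0 ?(ltW t0) ?(ltW y0)// ltr_pdivrMr ?mul1r.
  exact: cvg_expr ty1.
apply: nearW => n; have /andP[p0 _] := step_poly_itv t n y01; rewrite p0/=.
rewrite step_polyE in p0 *.
have yn0 : 0 < y ^+ n by rewrite exprn_gt0.
have tn0 : 0 < t ^+ n by rewrite exprn_gt0.
have a01 : 0 <= y ^+ n <= 1 by rewrite ltW// exprn_ile1// ltW.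
have := bernoulli_inequality_upper (step_exponent t n) a01.
set q := _ ^+ step_exponent t n in p0 *; move=> q1.
have tm : t ^- n <= (step_exponent t n)%:R by rewrite ltW// truncnS_gt.
rewrite expr_div_n ler_pdivlMr//.
have : 1 <= (step_exponent t n)%:R * t ^+ n.
  by rewrite -ler_pdivrMr// mul1r.
set M := _%:R in q1 *; set a := y ^+ n in q1 yn0 *; set b := t ^+ n in tn0 *.
move=> Mb; apply: (@le_trans _ _ (q * a * (M * b))).
  by rewrite ler_peMr// mulr_ge0// (ltW yn0).
rewrite [leLHS](_ : _ = q * (M * a) * b); last by ring.
rewrite -[leRHS]mul1r ler_wpM2r ?(ltW tn0)//; apply: le_trans q1.
by rewrite ler_wpM2l// lerDr.
Qed.

(** * Functions on the unit interval with vanishing moments *)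

Section moments.
Context {R : realType}.
Local Notation mu := (@lebesgue_measure R).
Implicit Types (g : R -> R) (p : {poly R}).

Lemma integrable_mul_onemX g n :
  mu.-integrable `[0, 1] (EFin \o g) ->
  mu.-integrable `[0, 1] (fun x => (g x * (1 - x) ^+ n)%:E).
Proof.
move=> ig; have mg := measurable_int _ ig.
apply: le_integrable ig => //.
  apply/measurable_EFinP; apply: measurable_funM; first exact/measurable_EFinP.
  by apply: measurable_funX; exact: measurable_funB.
move=> x /=; rewrite in_itv/= => /andP[x0 x1]; rewrite lee_fin normrM.
rewrite ler_piMr// ger0_norm ?exprn_ge0 ?exprn_ile1 ?subr_ge0//.
by rewrite lerBlDr lerDl.
Qed.

Lemma integral_mul_poly0 g p :
  mu.-integrable `[0, 1] (EFin \o g) ->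
  (forall n, \int[mu]_(x in `[0%R, 1%R]) (g x * (1 - x) ^+ n)%:E = 0)%E ->
  (\int[mu]_(x in `[0%R, 1%R]) (g x * p.[1 - x])%:E = 0)%E.
Proof.
move=> ig g0.
under eq_integral => x _.
  rewrite horner_coef mulr_sumr -sumEFin.
  under eq_bigr do rewrite mulrCA EFinM.
  over.
rewrite /=.
rewrite integral_sum//; last first.
  by move=> i; apply: integrableZl => //; exact: integrable_mul_onemX.
rewrite big1// => i _; rewrite integralZl//; last exact: integrable_mul_onemX.
by rewrite g0 mule0.
Qed.

(** The polynomials [1 - step_poly (1 - s) n], taken at [1 - x], stay in [[0, 1]]
and converge to the indicator of [x < s] except at [x = s]. Each integrates to [0]
against [g], and dominated convergence passes this on to the limit. *)
Lemma integral_initial_itv0 g (s : R) : 0 < s < 1 ->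
  mu.-integrable `[0, 1] (EFin \o g) ->
  (forall n, \int[mu]_(x in `[0%R, 1%R]) (g x * (1 - x) ^+ n)%:E = 0)%E ->
  (\int[mu]_(x in `[0%R, s]) (g x)%:E = 0)%E.
Proof.
move=> /andP[s0 s1] ig g0.
pose t := 1 - s.
have t0 : 0 < t by rewrite subr_gt0.
have t1 : t <= 1 by rewrite lerBlDr lerDl ltW.
pose f n x := (g x * (1 - (step_poly t n).[1 - x]))%:E.
pose h x := (g x * \1_(`[0, s]%classic) x)%:E.
have mg : measurable_fun `[(0 : R), 1] g.
  by have := measurable_int _ ig => /measurable_EFinP.
have := @dominated_convergence _ (measurableTypeR R) R mu
  (`[0, 1]%classic : set R) _ f h (EFin \o (fun x => `|g x|)).
case.
- by [].
- move=> n; apply/measurable_EFinP; apply: measurable_funM => //.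
  apply: measurable_funB => //.
  apply: (measurableT_comp (f := horner (step_poly t n))).
    by apply: continuous_measurable_fun; exact: continuous_horner.
  exact: measurable_funB.
- apply/measurable_EFinP; apply: measurable_funM => //.
- exists [set s]; split => //; first exact: lebesgue_measure_set1.
  move=> x /= /not_implyP[]; rewrite in_itv/= => /andP[x0 x1] fx.
  apply: contrapT => /eqP xs; apply: fx; apply: cvg_EFin; first exact: nearW.
  apply: cvgM; first exact: cvg_cst.
  rewrite indicE; move: xs; rewrite neq_lt => /orP[xs|xs].
    rewrite mem_set; last by rewrite /= in_itv/= x0 ltW.
    rewrite -[X in _ --> X]subr0; apply: cvgB; first exact: cvg_cst.
    by apply: step_poly_cvg0 => //; rewrite /t; lra.
  rewrite memNset; last by rewrite /= in_itv/= x0/= leNgt xs.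
  rewrite -[X in _ --> X](subrr 1); apply: cvgB; first exact: cvg_cst.
  by apply: step_poly_cvg1; rewrite ?t0// /t; lra.
- move/integrable_abse : ig; congr (mu.-integrable _ _).
- apply/aeW => x n /=; rewrite in_itv/= => /andP[x0 x1]; rewrite lee_fin normrM.
  have /andP[p0 p1] : 0 <= (step_poly t n).[1 - x] <= 1.
    by apply: step_poly_itv; lra.
  by rewrite ler_piMr// ger0_norm; lra.
move=> ih _; rewrite [X in X @ _ --> _](_ : _ = cst 0%E); last first.
  apply/funext => n; rewrite /= -(@integral_mul_poly0 g (1 - step_poly t n))//.
  by apply: eq_integral => x _; rewrite hornerD hornerN hornerE.
move=> /(cvg_unique (@ereal_hausdorff R) (cvg_cst _)) h0.
rewrite [RHS]h0 (_ : `[0, s]%classic = `[0, 1] `&` `[0, s]); last first.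
  by rewrite setIidr//; apply: subset_itvl; rewrite bnd_simp ltW.
rewrite integral_mkcondr; apply: eq_integral => x _.
by rewrite /h patchE indicE; case: ifPn; rewrite ?mulr1 ?mulr0.
Qed.

(** The primitive of [g] is identically [0] by [integral_initial_itv0], and almost
everywhere its derivative is [g] by Lebesgue differentiation. *)
Lemma moments_ae_eq0 g :
  mu.-integrable `[0, 1] (EFin \o g) ->
  (forall n, \int[mu]_(x in `[0%R, 1%R]) (g x * (1 - x) ^+ n)%:E = 0)%E ->
  {ae mu, forall x, 0 < x < 1 -> g x = 0}.
Proof.
move=> ig g0.
pose G := g \_ `[0, 1].
have iG : mu.-integrable [set: R] (EFin \o G).
  by rewrite -restrict_EFin; apply/integrable_restrict => //=; rewrite setTI.
have iG' y : mu.-integrable [set` Interval (BLeft (0:R)) (BRight y)] (EFin \o G).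
  exact: integrableS iG.
have := FTC1 iG' (open_integrable_locally openT iG).
apply: filterS; first exact: (ae_filter_ringOfSetsType mu).
move=> x /= + /andP[x0 x1].
case; first by rewrite lte_fin.
move=> _; rewrite {2}/G patchE mem_set; last by rewrite /= in_itv/= !ltW.
move=> <-.
have Fx : \forall y \near x, \int[mu]_(z in `[0, y]) G z = 0.
  near=> y.
  have y0 : 0 < y by near: y; exact: lt_nbhsr.
  have y1 : y < 1 by near: y; exact: lt_nbhsl.
  rewrite /Rintegral [X in fine X](_ : _ = 0%E)//.
  rewrite -[RHS](@integral_initial_itv0 g y) ?y0//.
  apply: eq_integral => z /set_mem/=; rewrite in_itv/= => /andP[z0 zy].
  by rewrite /G patchE mem_set//= in_itv/= z0 (le_trans zy (ltW y1)).
by rewrite derive1E (@near_eq_derive _ _ _ _ (cst (0 : R)) _ _ Fx) derive_cst.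
Unshelve. all: by end_near. Qed.

End moments.

(** * Binomial tails and the cumulative distribution of beta laws *)

(** The probability that a binomial variable with [n] trials is at least [k], as a
polynomial in the success probability. *)
Definition binomial_tail (R : nzRingType) (n k : nat) : {poly R} :=
  \sum_(k <= j < n.+1) 'C(n, j)%:R *: ('X^j * (1 - 'X) ^+ (n - j)).

(** Differentiating the summand of index [j] gives two terms, the second of which
cancels the first one of index [j.+1]; only the first term of the lowest
summand survives. The induction peels off the summand of lowest index. *)
Lemma deriv_binomial_tail (R : comNzRingType) (k m : nat) :
  (binomial_tail R (k + m).+1 k.+1)^`() =
    ((k + m).+1 * 'C(k + m, k))%:R *: ('X^k * (1 - 'X) ^+ m).
Proof.
elim: m k => [|m ih] k.
  rewrite /binomial_tail addn0 big_nat1 !binn subnn expr0 !mulr1 scale1r muln1.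
  by rewrite derivXn scaler_nat.
have km : (k + m.+1 = k.+1 + m)%N by rewrite addnS.
rewrite /binomial_tail big_ltn; last by rewrite !ltnS leq_addr.
rewrite -/(binomial_tail _ _ _) derivD derivZ derivM derivXn deriv_exp.
rewrite derivB derivX -(polyC1 R) derivC sub0r polyC1 [in binomial_tail _ _ _]km.
rewrite ih subSS addKn /= !scaler_nat.
have e1 : (k.+1 * 'C((k + m.+1).+1, k.+1) = (k + m.+1).+1 * 'C(k + m.+1, k))%N.
  by rewrite -mul_bin_diag.
have e2 : (m.+1 * 'C((k + m.+1).+1, k.+1) = (k.+1 + m).+1 * 'C(k.+1 + m, k.+1))%N.
  by rewrite -km mul_bin_down subSS addKn.
rewrite -e1 -e2 mulNr mulNrn mulrN mul1r mulrnDl mulNrn mulrnAl mulrnAr.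
by rewrite -!mulrnA subrK.
Qed.

(** The cumulative distribution function of the uniform law on [[0, 1]]. *)
Definition clip01 (R : realDomainType) (x : R) : R := Num.max 0 (Num.min x 1).

Lemma clip01_itv (R : realDomainType) (x : R) : 0 <= clip01 x <= 1.
Proof. by rewrite /clip01 le_max lexx/= ge_max ler01 ge_min lexx orbT. Qed.

Section beta_cdf.
Context {R : realType}.
Local Notation mu := (@lebesgue_measure R).

Lemma binomial_tail0 n k : (binomial_tail R n k.+1).[0] = 0.
Proof.
rewrite /binomial_tail horner_sum big_nat_cond big1// => -[|j] /andP[/andP[]]//.
by move=> _ _ _; rewrite hornerZ hornerM hornerXn expr0n mul0r mulr0.
Qed.

Lemma beta_funV k m :
  (@beta_fun R k.+1 m.+1)^-1 = ((k + m).+1 * 'C(k + m, k))%:R.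
Proof.
rewrite beta_fun_fact invf_div; apply: canLR (mulfK _) _.
  by rewrite pnatr_eq0 -lt0n muln_gt0 !fact_gt0.
rewrite -natrM; congr (_%:R); rewrite factS -mulnA; congr muln.
by rewrite -(bin_fact (leq_addr m k)) addKn mulnC.
Qed.

(** On [[0, 1]] the beta density is the derivative of [binomial_tail] by
[deriv_binomial_tail] and [beta_funV], so the fundamental theorem of calculus
applies; clipping [x] covers the rays that end outside [[0, 1]]. *)
Lemma beta_prob_cdf k m x :
  beta_prob k.+1 m.+1 `]-oo, x] =
  ((binomial_tail R (k + m).+1 k.+1).[clip01 x])%:E.
Proof.
rewrite -integral_beta_pdf//.
pose p := binomial_tail R (k + m).+1 k.+1.
have pE t : p^`().[t] = XMonemX k m t / beta_fun k.+1 m.+1.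
  rewrite /p deriv_binomial_tail beta_funV hornerZ hornerM hornerXn mulrC.
  by rewrite horner_exp hornerD hornerN hornerX hornerC.
transitivity (\int[mu]_(t in `]-oo, x] `&` `[0%R, 1%R]) (p^`().[t])%:E)%E.
  rewrite integral_mkcondr; apply: eq_integral => t _.
  by rewrite /beta_pdf !patchE; case: ifPn; rewrite ?pE// mul0r.
have [x0|x0] := ltP x 0.
  rewrite /clip01 max_l ?ge_min ?(ltW x0)// binomial_tail0.
  rewrite (_ : _ `&` _ = set0) ?integral_set0//; apply/seteqP; split => // t [].
  by rewrite /= !in_itv/= => tx /andP[t0 _]; lra.
have -> : `]-oo, x]%classic `&` `[0%R, 1%R] = `[0%R, clip01 x]%classic.
  apply/seteqP; split => t; rewrite /= !in_itv/= /clip01 le_max le_min.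
    by move=> [-> /andP[-> ->]]; rewrite orbT.
  by move=> /andP[t0 /orP[t0'|/andP[-> ->]]]; rewrite t0//; split; lra.
have /andP[+ _] := clip01_itv x.
rewrite le_eqVlt => /predU1P[<-|c0].
  by rewrite set_itv1 integral_set1 binomial_tail0.
rewrite (continuous_FTC2 (F := horner p))//.
- by rewrite /p binomial_tail0 sube0.
- exact/continuous_subspaceT/continuous_horner.
- split; first by move=> t _; exact: derivable_horner.
    exact/cvg_at_right_filter/continuous_horner.
  exact/cvg_at_left_filter/continuous_horner.
- by move=> t _; rewrite derivE.
Qed.

End beta_cdf.

(** Complements of these rays form a family stable under intersection that
generates the Borel sets, so the uniqueness theorem for finite measures
applies. *)
Lemma eq_probability_rays (R : realType) (P Q : probability (measurableTypeR R) R) :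
  (forall x : R, P `]-oo, x]%classic = Q `]-oo, x]%classic) ->
  forall A, measurable A -> P A = Q A.
Proof.
move=> PQ A mA.
have PQy (x : R) : P `]x, +oo[%classic = Q `]x, +oo[%classic.
  by rewrite -setCitvl (probability_setC P)// (probability_setC Q)// PQ.
have := @measure_unique _ R (measurableTypeR R) (@RGenOInfty.G R)
  (fun j : nat => `](- j%:R : R), +oo[%classic) _ _ _ _ P Q; apply => //.
- exact: RGenOInfty.measurableE.
- move=> _ _ [x ->] [y ->]; exists (Num.max x y).
  by apply/seteqP; split => z; rewrite /= !in_itv/= !andbT gt_max => /andP.
- by move=> k; exists (- k%:R).
- apply/seteqP; split => // x _; exists (Num.bound `|x|) => //=.
  rewrite in_itv/= andbT ltrNl; apply: le_lt_trans (archi_boundP (normr_ge0 x)).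
  by rewrite -normrN ler_norm.
- move=> _ [x ->]; exact: PQy.
- move=> k; apply: le_lt_trans (probability_le1 _ _) _ => //; exact: ltry.
Qed.

(** * Order statistics of a uniform sample *)

Lemma nth_sort_le (R : realDomainType) (s : seq R) (j : nat) (x : R) :
  (j < size s)%N -> (nth 0 (sort <=%R s) j <= x) = (j < count (<= x)%R s)%N.
Proof.
move=> js; have ss : sorted <=%O (sort <=%R s) by exact: sort_sorted le_total _.
have [jc|jc] := ltnP j.
  by apply: nth_count_le => //; rewrite (permP (permEl (perm_sort _ _))).
apply/negbTE; rewrite -ltNge; apply: nth_count_gt => //.
by rewrite (permP (permEl (perm_sort _ _))) jc size_sort.
Qed.

Section order_statistic.
Context d (T : measurableType d) (R : realType) (P : probability T R).
Context (k n : nat) (X : 'I_n -> {RV P >-> R}).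
Hypothesis kn : (0 < k <= n)%N.

Lemma kth_smallest_le w x :
  (kth_smallest k X w <= x) = (k <= #|[set i | (X i w <= x)%R]%SET|)%N.
Proof.
have /andP[k0 kn'] := kn.
rewrite /kth_smallest nth_sort_le; last by rewrite size_map size_enum_ord prednK.
rewrite prednK// count_map cardE [in RHS]/enum_mem size_filter -enumT.
by congr (k <= _)%N; apply: eq_count => i /=; rewrite inE.
Qed.

(** The sample space is cut according to the exact set of indices whose value is at
most [x]; each piece is an intersection of independent events. *)
Let sample_event x (J : {set 'I_n}) : set T :=
  [set w | [set i | X i w <= x]%SET = J].

Let sample_ray x (J : {set 'I_n}) (i : 'I_n) : set R :=
  if i \in J then `]-oo, x]%classic else `]x, +oo[%classic.

Let sample_eventE x J :
  sample_event x J = \bigcap_(i in [set` [set: 'I_n]%SET]) (X i @^-1` sample_ray x J i).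
Proof.
apply/seteqP; split => w /=.
  move=> <- i _; rewrite /sample_ray /= inE; case: ltP => /= h; rewrite in_itv/= ?andbT//.
move=> h; apply/setP => i; rewrite inE; have := h i.
rewrite /sample_ray/= inE => /(_ isT).
by case: ifP => _ /=; rewrite in_itv/= ?andbT// ltNge => /negbTE.
Qed.

Let measurable_sample_ray x J i : measurable (sample_ray x J i).
Proof. by rewrite /sample_ray; case: ifP. Qed.

Let measurable_sample_event x J : measurable (sample_event x J).
Proof.
rewrite sample_eventE; apply: fin_bigcap_measurable => // i _.
exact: measurable_funPTI.
Qed.

Let kth_smallest_le_event x :
  kth_smallest k X @^-1` `]-oo, x] =
  \bigcup_(J in [set J : {set 'I_n} | (k <= #|J|)%N]) sample_event x J.
Proof.
apply/seteqP; split => w /=; rewrite in_itv/= kth_smallest_le.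
  by move=> h; exists [set i | X i w <= x]%SET.
by case=> J /= h; rewrite /sample_event/= => ->.
Qed.

Let measurable_kth_smallest_le x :
  measurable (kth_smallest k X @^-1` `]-oo, x]).
Proof.
by rewrite kth_smallest_le_event; apply: fin_bigcup_measurable => // J _.
Qed.

Lemma measurable_kth_smallest : measurable_fun [set: T] (kth_smallest k X).
Proof.
apply: (measurability _ (RGenOInfty.measurableE R)) => // _ [_ [x ->] <-].
rewrite setTI -setCitvl preimage_setC; apply: measurableC.
exact: measurable_kth_smallest_le.
Qed.

Hypothesis iidX : iid_uniform01 X.

(** The uniform law is Beta(1, 1), whose cumulative distribution is known. *)
Let uniform_ray i x : P (X i @^-1` `]-oo, x]) = (clip01 x)%:E.
Proof.
have [_ /(_ i) uX] := iidX.
have := uX `]-oo, x]%classic (measurable_itv _).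
rewrite -beta_prob_uniform (beta_prob_cdf 0 0) /distribution /pushforward => ->.
rewrite /binomial_tail big_nat1 binn subnn expr0 mulr1 expr1 scale1r.
by rewrite hornerX.
Qed.

Let prob_sample_event x J :
  P (sample_event x J) = (clip01 x ^+ #|J| * (1 - clip01 x) ^+ (n - #|J|))%:E.
Proof.
have [indX _] := iidX.
rewrite sample_eventE indX//.
rewrite (eq_bigr (fun i => (if i \in J then clip01 x else 1 - clip01 x)%:E)); last first.
  move=> i _; rewrite /sample_ray; case: ifP => _; first exact: uniform_ray.
  have -> : X i @^-1` `]x, +oo[%classic = ~` (X i @^-1` `]-oo, x]).
    by rewrite -setCitvl.
  by rewrite probability_setC ?uniform_ray//; exact: measurable_funPTI.
rewrite prodEFin; congr EFin.
rewrite (bigID (mem J))/=; congr (_ * _).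
  rewrite (eq_bigr (fun=> clip01 x)); last by move=> i /andP[_ ->].
  by rewrite prodr_const; congr (_ ^+ _); apply: eq_card => i; rewrite unfold_in/= !inE.
rewrite (eq_bigr (fun=> 1 - clip01 x)); last by move=> i /andP[_ /negbTE ->].
rewrite prodr_const; congr (_ ^+ _).
have -> : (n - #|J| = #|~: J|%SET)%N
  by rewrite -{1}(card_ord n) -(cardsC J) addKn.
by apply: eq_card => i; rewrite unfold_in/= !inE.
Qed.

(** The probability of a piece depends only on the size [j] of its index set, and
there are ['C(n, j)] index sets of that size. *)
Lemma kth_smallest_cdf x : P (kth_smallest k X @^-1` `]-oo, x]) =
  ((binomial_tail R n k).[clip01 x])%:E.
Proof.
have fin : finite_set [set J : {set 'I_n} | (k <= #|J|)%N] by exact: finite_finset.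
rewrite kth_smallest_le_event measure_fin_bigcup//; last first.
  by move=> J1 J2 _ _ [w []]; rewrite /sample_event/= => -> //.
rewrite (_ : [set J | _] =
  [set` [seq J : {set 'I_n} <- enum {: {set 'I_n}} | (k <= #|J|)%N]]); last first.
  by apply/seteqP; split => J /=; rewrite mem_filter mem_enum andbT.
rewrite -fsbig_seq; last by rewrite filter_uniq// enum_uniq.
rewrite big_filter big_enum_cond/=.
under eq_bigr do rewrite prob_sample_event.
rewrite sumEFin; congr EFin.
(* [inord] is harmless: the size of an index set is at most [n]. *)
rewrite (partition_big (fun J : {set 'I_n} => inord #|J| : 'I_n.+1)
  (fun j : 'I_n.+1 => (k <= j)%N))/=; last first.
  by move=> J; rewrite inordK// ltnS -[leqRHS](card_ord n) max_card.
rewrite /binomial_tail horner_sum (big_nat_widenl _ 0%N)// big_mkord.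
apply: eq_bigr => j kj; rewrite hornerZ hornerM hornerXn horner_exp.
rewrite hornerD hornerN hornerX hornerC.
rewrite (eq_bigl (fun J : {set 'I_n} => J \in [set J : {set 'I_n} | #|J| == j]%SET)).
  rewrite (eq_bigr (fun=> clip01 x ^+ j * (1 - clip01 x) ^+ (n - j))).
    by rewrite sumr_const card_draws card_ord mulr_natl.
  by move=> J; rewrite inE => /eqP ->.
move=> J; rewrite inE -val_eqE/= inordK; last first.
  by rewrite ltnS -[leqRHS](card_ord n) max_card.
by case: eqP => [->|]; rewrite ?kj ?andbF.
Qed.
End order_statistic.

(** * Integrals against the law of an order statistic *)

Lemma measurable_fun_inv (R : realType) :
  measurable_fun [set: R] (fun x : R => x^-1).
Proof.
rewrite -(setUv [set (0 : R)]); apply/measurable_funU => //.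
  exact: measurableC.
split; first exact: measurable_fun_set1.
apply: open_continuous_measurable_fun.
  by apply: closed_openC; exact: closed_eq.
by move=> x; rewrite inE/= => /eqP x0; exact: inv_continuous.
Qed.

Section beta_integral.
Context {R : realType}.
Local Notation mu := (@lebesgue_measure R).
Local Open Scope ereal_scope.

(** The beta density is almost everywhere the Radon-Nikodym derivative, since both
have the same integral on every Borel set. Both sides take
values in [[0, +oo]], and finiteness can be read off from either. *)
Lemma ge0_integral_beta_prob a b (f : R -> \bar R) :
  measurable_fun [set: R] f -> (forall x, 0 <= f x) ->
  \int[beta_prob a b]_x f x = \int[mu]_x (f x * (beta_pdf a b x)%:E).
Proof.
move=> mf f0; have dom := @beta_prob_dom R a b.
rewrite -(Radon_Nikodym_SigmaFinite.change_of_variables dom)//.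
have iRN := Radon_Nikodym_SigmaFinite.f_integrable dom.
have mpdf : measurable_fun [set: R] (EFin \o beta_pdf a b).
  by apply/measurable_EFinP; exact: measurable_beta_pdf.
apply: ae_eq_integral => //.
- by apply: emeasurable_funM => //; exact: measurable_int iRN.
- exact: emeasurable_funM.
apply: ae_eqe_mul2l; apply: integral_ae_eq => // A _ mA.
by rewrite -(Radon_Nikodym_SigmaFinite.f_integral dom)// integral_beta_pdf.
Qed.

(** The density being nonnegative, multiplying by it commutes with taking positive
and negative parts; so both sides are the same difference in [[-oo, +oo]]. *)
Lemma integral_beta_prob_pdf a b (f : R -> R) : measurable_fun [set: R] f ->
  \int[beta_prob a b]_x (f x)%:E = \int[mu]_x (f x * beta_pdf a b x)%:E.
Proof.
move=> mf; have mfE : measurable_fun [set: R] (EFin \o f) by exact/measurable_EFinP.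
rewrite integralE [RHS]integralE; congr (_ - _).
  rewrite ge0_integral_beta_prob//; last exact: measurable_funepos.
  apply: eq_integral => x _; rewrite !funeposE/= -!EFin_max -EFinM.
  by rewrite maxr_pMl ?beta_pdf_ge0// mul0r.
rewrite ge0_integral_beta_prob//; last exact: measurable_funeneg.
apply: eq_integral => x _; rewrite !funenegE/= -!EFin_max -EFinM.
by rewrite maxr_pMl ?beta_pdf_ge0// mul0r mulNr.
Qed.
End beta_integral.

Section law.
Context d (T : measurableType d) (R : realType) (P : probability T R).
Context (k n : nat) (X : 'I_n -> {RV P >-> R}).
Hypothesis kn : (0 < k <= n)%N.
Hypothesis iidX : iid_uniform01 X.
Local Notation mu := (@lebesgue_measure R).

(** The codomain is the copy of [R] that carries the beta laws, so that the two laws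
are measures on the same measurable type. *)
Let Y : {RV P >-> measurableTypeR R} :=
  HB.pack_for {RV P >-> measurableTypeR R}
    (kth_smallest k X : T -> measurableTypeR R)
    (@isMeasurableFun.Build _ _ T (measurableTypeR R) _
       (measurable_kth_smallest X kn)).

Lemma kth_smallest_beta (A : set R) : measurable A ->
  distribution P Y A = beta_prob k (n - k).+1 A.
Proof.
move=> mA.
have := @eq_probability_rays R (distribution P Y) (beta_prob k (n - k).+1) _ A mA.
apply => x; have [k0 kn'] := andP kn.
have := @beta_prob_cdf R k.-1 (n - k) x; rewrite prednK// => cdfx.
rewrite [RHS]cdfx [LHS]kth_smallest_cdf//.
by have -> : (k.-1 + (n - k)).+1 = n by lia.
Qed.

(** Transfer of the law is applied to the positive and the negative part of [f]
separately, so that the two sides are infinite or finite together; this turns a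
finite expectation of an estimator into integrability against the density. *)
Lemma expectation_kth_smallest (f : R -> R) : measurable_fun [set: R] f ->
  ('E_P[f \o kth_smallest k X] = \int[mu]_x (f x * beta_pdf k (n - k).+1 x)%:E)%E.
Proof.
move=> mf; rewrite -integral_beta_prob_pdf// unlock.
have mfE : measurable_fun [set: R] (EFin \o f) by exact/measurable_EFinP.
have h (g : R -> \bar R) : measurable_fun [set: R] g -> (forall x, 0 <= g x)%E ->
  (\int[P]_w (g \o Y) w = \int[beta_prob k (n - k).+1]_x g x)%E.
  move=> mg g0; rewrite -ge0_integral_distribution//.
  by apply: eq_measure_integral => A mA _; exact: kth_smallest_beta.
have hp := h _ (measurable_funepos mfE) (funepos_ge0 _).
have hn := h _ (measurable_funeneg mfE) (funeneg_ge0 _).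
rewrite integralE [RHS]integralE -hp -hn -funepos_comp -funeneg_comp.
reflexivity.
Qed.

Lemma variance_kth_smallest (f : R -> R) (c : R) : measurable_fun [set: R] f ->
  ('E_P[f \o kth_smallest k X] = c%:E)%E ->
  ('V_P[f \o kth_smallest k X] =
   \int[mu]_x ((f x - c) ^+ 2 * beta_pdf k (n - k).+1 x)%:E)%E.
Proof.
move=> mf Ef; rewrite /variance covariance.unlock Ef/=.
rewrite -(expectation_kth_smallest (f := fun x => (f x - c) ^+ 2)); last first.
  by apply: measurable_funX; exact: measurable_funB.
by congr expectation; apply/funext => w.
Qed.
End law.

(** * Completeness of the beta family *)

Section beta_family.
Context {R : realType}.
Local Notation mu := (@lebesgue_measure R).

Lemma measurable_xi_hat k : measurable_fun [set: R] (xi_hat k).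
Proof. by apply: measurable_funM => //; exact: measurable_fun_inv. Qed.

Lemma beta_pdf_in a b (x : R) : 0 <= x <= 1 ->
  beta_pdf a.+1 b.+1 x = x ^+ a * (1 - x) ^+ b / beta_fun a.+1 b.+1.
Proof. by move=> x01; rewrite /beta_pdf patchE mem_set//= in_itv. Qed.

Lemma beta_pdf_out a b (x : R) : ~~ (0 <= x <= 1) -> beta_pdf a b x = 0.
Proof. by move=> /negP x01; rewrite /beta_pdf patchE memNset ?mul0r//= in_itv. Qed.

(** Dividing the density [x^(k-1) (1-x)^m / B(k, m+1)] by [x] leaves the kernel of
Beta(k-1, m+1), so the mean is [(k-1) B(k-1, m+1) / B(k, m+1) = k + m]. The two
integrands may differ at [x = 0], where the kernel is [1] if [k = 2]. *)
Lemma integral_xi_hat_beta k m : (2 <= k)%N ->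
  (\int[mu]_x (xi_hat k x * beta_pdf k m.+1 x)%:E = (k + m)%:R%:E)%E.
Proof.
case: k => [|[|k]]// _.
pose c : R := k.+1%:R / beta_fun k.+2 m.+1.
transitivity (\int[mu]_x (c%:E * ((@XMonemX R k m : R -> R) \_ `[0%R, 1%R] x)%:E))%E.
  apply: ae_eq_integral => //.
  - apply/measurable_EFinP; apply: measurable_funM; first exact: measurable_xi_hat.
    exact: measurable_beta_pdf.
  - apply/measurable_EFinP; apply: measurable_funM => //.
    by apply/measurable_restrict => //; rewrite setTI; exact: measurable_XMonemX.
  exists [set 0]; split => //; first exact: lebesgue_measure_set1.
  move=> x /= h; apply: contrapT => /eqP x0; apply: h => _.
  rewrite -EFinM; congr EFin; rewrite patchE.
  have [x01|x01] := boolP (0 <= x <= 1); last first.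
    by rewrite beta_pdf_out// memNset ?mulr0//= in_itv; exact/negP.
  rewrite beta_pdf_in// mem_set/= ?in_itv// /xi_hat /c /XMonemX.
  rewrite /unstable.onem exprS -natr1.
  by field; rewrite x0 gt_eqF ?beta_fun_gt0.
rewrite integralZl//; last exact: (@integrable_XMonemX_restrict _ k.+1 m.+1).
rewrite -(EFin_beta_fun k.+1 m.+1) -EFinM; congr EFin.
rewrite /c !beta_fun_fact addSn !factS !natrM.
have f0 j : j`!%:R != 0 :> R by rewrite pnatr_eq0 -lt0n fact_gt0.
by field; rewrite !f0 !lt0r_neq0 ?ltr_pwDl ?addr_ge0 ?ler0n.
Qed.

(** Equality of the means for Beta(k+1, m+1), for all [m], says that
[(f1 x - f2 x) x^k] is orthogonal to every [(1-x)^m]. Finiteness for [m = 0]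
gives the integrability of that function. *)
Lemma beta_family_complete k (f1 f2 : R -> R) :
  measurable_fun [set: R] f1 -> measurable_fun [set: R] f2 ->
  (forall m, \int[mu]_x (f1 x * beta_pdf k.+1 m.+1 x)%:E \is a fin_num)%E ->
  (forall m, \int[mu]_x (f1 x * beta_pdf k.+1 m.+1 x)%:E =
             \int[mu]_x (f2 x * beta_pdf k.+1 m.+1 x)%:E)%E ->
  {ae mu, forall x, 0 < x < 1 -> f1 x = f2 x}.
Proof.
move=> mf1 mf2 fin1 f12.
have fin2 m : (\int[mu]_x (f2 x * beta_pdf k.+1 m.+1 x)%:E \is a fin_num)%E.
  by rewrite -f12.
have int (f : R -> R) m : measurable_fun [set: R] f ->
    (\int[mu]_x (f x * beta_pdf k.+1 m.+1 x)%:E \is a fin_num)%E ->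
    mu.-integrable [set: R] (fun x => (f x * beta_pdf k.+1 m.+1 x)%:E).
  move=> mf fin; have mfp : measurable_fun [set: R] (fun x => f x * beta_pdf k.+1 m.+1 x).
    by apply: measurable_funM => //; exact: measurable_beta_pdf.
  apply/integrableP; split; first exact/measurable_EFinP.
  by rewrite integral_fin_num_abs.
pose g x := (f1 x - f2 x) * x ^+ k.
pose B m : R := beta_fun k.+1 m.+1.
pose D m x := ((B m)%:E *
  ((f1 x * beta_pdf k.+1 m.+1 x)%:E - (f2 x * beta_pdf k.+1 m.+1 x)%:E))%E.
have gE m x : `[0, 1]%classic x -> (g x * (1 - x) ^+ m)%:E = D m x.
  rewrite /= in_itv/= => x01; rewrite /D -EFinB -EFinM beta_pdf_in// /g /B; congr EFin.
  by field; rewrite gt_eqF ?beta_fun_gt0.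
have iD m : mu.-integrable [set: R] (D m).
  by apply: integrableZl => //; apply: integrableB => //; exact: int.
have ig : mu.-integrable `[0, 1] (EFin \o g).
  have iD0 : mu.-integrable `[0, 1] (D 0%N) by exact: integrableS (iD 0%N).
  apply: eq_integrable iD0 => //.
  by move=> x /set_mem x01; rewrite -gE// expr0 mulr1.
have : {ae mu, forall x, 0 < x < 1 -> g x = 0}.
  apply: moments_ae_eq0 => // m.
  transitivity (\int[mu]_x D m x)%E.
    rewrite integral_mkcond; apply: eq_integral => x _; rewrite patchE.
    case: ifPn => [/set_mem|/negP]; first exact: gE.
    rewrite inE/= in_itv/= => /negP x01.
    by rewrite /D beta_pdf_out// !mulr0 subee// mule0.
  rewrite integralZl//; last by apply: integrableB => //; exact: int.
  by rewrite integralB ?f12 ?subee ?mule0//; exact: int.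
apply: filterS; first exact: (ae_filter_ringOfSetsType mu).
move=> x /= gx x01; have /eqP := gx x01.
rewrite /g mulf_eq0 expf_eq0 (gt_eqF (proj1 (andP x01))) andbF orbF subr_eq0.
by move=> /eqP.
Qed.

End beta_family.

(** * The minimum-variance unbiased estimator *)

Theorem theorem3p3 (R : realType) (k : nat) (hk : (2 <= k)%N)
    (d : nat -> measure_display)
    (T : forall theta : nat, measurableType (d theta))
    (P : forall theta : nat, probability (T theta) R)
    (X : forall theta : nat, 'I_theta -> {RV (P theta) >-> R})
    (hX : forall theta : nat, (k <= theta)%N -> iid_uniform01 (@X theta)) :
  unbiased k X (@xi_hat R k) /\
  (forall phi : R -> R, unbiased k X phi ->
   forall theta : nat, (k <= theta)%N ->
     ('V_(P theta)[@xi_hat R k \o kth_smallest k (@X theta)] <=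
      'V_(P theta)[phi \o kth_smallest k (@X theta)])%E).
Proof.
have k0 : (0 < k)%N by exact: ltnW.
have kn theta : (k <= theta)%N -> (0 < k <= theta)%N by move=> ->; rewrite k0.
have xiU : unbiased k X (@xi_hat R k).
  split=> [|theta kt]; first exact: measurable_xi_hat.
  rewrite expectation_kth_smallest ?kn//; last 2 first.
    exact: hX.
    exact: measurable_xi_hat.
  by rewrite integral_xi_hat_beta// subnKC.
split=> // phi phiU theta kt.
have [[mphi Ephi] [mxi Exi]] := (phiU, xiU).
have pdf_mean f : unbiased k X f -> forall m,
    (\int[@lebesgue_measure R]_x (f x * beta_pdf k m.+1 x)%:E = (k + m)%:R%:E)%E.
  move=> [mf Ef] m; rewrite -(Ef _ (leq_addr m k)).
  rewrite expectation_kth_smallest ?addKn//; first exact: kn (leq_addr _ _).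
  exact: hX (leq_addr _ _).
(* Completeness with [m = theta - k]: one sample size for each exponent. *)
have phi_xi : {ae @lebesgue_measure R, forall x, 0 < x < 1 -> phi x = xi_hat k x}.
  apply: (@beta_family_complete R k.-1) => // m; rewrite prednK// ?pdf_mean//.
(* Equality holds: the integrands of the two variances agree almost everywhere. *)
rewrite le_eqVlt; apply/orP; left; apply/eqP.
rewrite (variance_kth_smallest (kn _ kt) (hX _ kt) mxi (Exi _ kt)).
rewrite (variance_kth_smallest (kn _ kt) (hX _ kt) mphi (Ephi _ kt)).
have mint (f : R -> R) : measurable_fun [set: R] f -> measurable_fun [set: R]
    (fun x => ((f x - theta%:R) ^+ 2 * beta_pdf k (theta - k).+1 x)%:E).
  move=> mf; apply/measurable_EFinP; apply: measurable_funM;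
    last exact: measurable_beta_pdf.
  by apply: measurable_funX; exact: measurable_funB.
apply: ae_eq_integral => //; [exact: mint|exact: mint|].
have ae_neq (a : R) : {ae @lebesgue_measure R, forall x, x <> a}.
  exists [set a]; split => //; first exact: lebesgue_measure_set1.
  by move=> x /= /contrapT.
have ae_filter := ae_filter_ringOfSetsType (@lebesgue_measure R).
move: phi_xi (ae_neq 0) (ae_neq 1); apply: filterS3 => x /= phix x0 x1 _.
have [x01|x01] := boolP (0 <= x <= 1); last by rewrite beta_pdf_out// !mulr0.
rewrite phix// !lt_neqAle eq_sym; case/andP: x01 => -> ->.
by rewrite !andbT; apply/andP; split; exact/eqP.
Qed.
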